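(* Let $\theta$ be a strongly injective primitive length $r$ substitution such that $X_\theta$ is infinite. If $\Phi\in\operatorname{Aut}(X_\theta,\sigma)$ satisfies $\kappa(\Phi)=0$, then $\Phi$ has radius $0$, and so in particular it is a language automorphism.
   Context: A substitution of (constant) length $r$ on a finite alphabet $\mathcal A$ is a map $\theta:\mathcal A\to\mathcal A^r$, extended by concatenation. It is primitive if there is $k$ such that for all $a,a'\in\mathcal A$ the word $\theta^k(a)$ contains $a'$. $X_\theta\subset\mathcal A^{\mathbb Z}$ is the shift-orbit closure of any bi-infinite $\theta$-periodic point (a point $v\cdot u$ with $v$ left-infinite and $u$ right-infinite $\theta$-periodic, whose central two-letter word $v_{-1}u_0$ occurs in some $\theta^k(a)$), and $\sigma$ is the left shift. $\operatorname{Aut}(X_\theta,\sigma)$ is the group of shift-commuting homeomorphisms of $X_\theta$. An automorphism $\Phi$ has radius $0$ if there is a map $\phi:\mathcal A\to\mathcal A$ with $\Phi(x)_n=\phi(x_n)$ for all $x$ and $n$. Strong injectivity: $\theta$ is injective if $\theta(a)\ne\theta(b)$ for distinct letters $a,b$. $\theta$ is strongly injective if it is injective, it does not have two distinct right-infinite fixed points $u=u_0u_1\ldots$ (that is, $\theta(u)=u$) which differ only in their initial entry $u_0$, and it does not have two distinct left-infinite fixed points $v=\ldots v_{-2}v_{-1}$ (that is, $\theta(v)=v$) which differ only in the entry $v_{-1}$ adjacent to the origin. The map $\kappa$: let $h=\max\{n\ge1:\gcd(n,r)=1,\ n\mid\gcd\{a:u_a=u_0\}\}$, for $u$ a one-sided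 fixed point of $\theta$ (or of a power of $\theta$), be the height of $\theta$. The maximal equicontinuous factor of $(X_\theta,\sigma)$ is $(\mathbb Z_r\times\mathbb Z/h\mathbb Z,+(1,1))$, where $\mathbb Z_r=\varprojlim\mathbb Z/r^n\mathbb Z$. The factor map $\pi$ is as follows: for every $n$, the $\mathbb Z_r$-coordinate of $\pi(x)$ is congruent mod $r^n$ to the unique $0\le i<r^n$ with $x\in\sigma^i(\theta^n(X_\theta))$; the second coordinate (trivial if $h=1$) is a fixed continuous map $p:X_\theta\to\mathbb Z/h\mathbb Z$ with $p(\sigma x)=p(x)+1$. For $\Phi\in\operatorname{Aut}(X_\theta,\sigma)$, the difference $\pi(\Phi(x))-\pi(x)$ does not depend on $x$ and is denoted $\kappa(\Phi)$. Language automorphism: for the language $\mathcal L$ of $X_\theta$ (all finite words occurring in points of $X_\theta$), this is a bijection $\Psi:\mathcal L\to\mathcal L$ with $\Psi(w_1w_2)=\Psi(w_1)\Psi(w_2)$ whenever $w_1,w_2,w_1w_2\in\mathcal L$; a radius $0$ automorphism acts on $\mathcal L$ letter by letter.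
   Formalization: The two fixed-point conditions of strong injectivity are required for every power of θ (that is, for one-sided θ-periodic points), not only for θ; with fixed points of θ alone the statement fails, e.g. for (a,m) ↦ (a+1,m)(a,[a+1=0]) with a in Z/3 and m in {0,1}. *)

(* Defs.v *)
From HB Require Import structures.
From mathcomp Require Import all_boot all_order all_algebra.
From mathcomp Require Import all_classical.
From mathcomp Require Import topology.

Set Implicit Arguments.
Unset Strict Implicit.
Unset Printing Implicit Defensive.

Import GRing.Theory.
Local Open Scope classical_set_scope.
Local Open Scope ring_scope.

Notation config A := {ptws int -> discrete_topology A}.

Section Shift.
Variable A : finType.

Definition shift (x : config A) : config A := fun n => x (n + 1).

Definition shiftz (i : int) (x : config A) : config A := fun n => x (n + i).

Definition orbit_closure (x : config A) : set (config A) :=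
  closure [set shiftz i x | i in [set: int]].

(* v lists a left-infinite word away from the origin: v n is the entry of index
   -(n+1), which is Negz n. *)
Definition bi_infinite (v u : nat -> A) : config A :=
  fun n => match n with Posz m => u m | Negz m => v m end.

Definition word_at (x : config A) (i : int) (l : nat) : seq A :=
  [seq x (i + Posz k) | k <- iota 0 l].

Definition language (X : set (config A)) : set (seq A) :=
  [set w | exists x i, X x /\ w = word_at x i (size w)].

Definition language_automorphism (L : set (seq A)) (Psi : seq A -> seq A) :=
  set_bij L L Psi /\
  forall w1 w2, L w1 -> L w2 -> L (w1 ++ w2) ->
    Psi (w1 ++ w2) = Psi w1 ++ Psi w2.

(* Maps of X are represented by maps of the full shift, whose values outside X
   are irrelevant. *)
Definition homeomorphism_of (X : set (config A)) (Phi : config A -> config A) :=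
  exists Psi : config A -> config A,
    [/\ forall x, X x -> X (Phi x) /\ Psi (Phi x) = x,
        forall x, X x -> X (Psi x) /\ Phi (Psi x) = x,
        {within X, continuous Phi}
      & {within X, continuous Psi}].

Definition automorphism (X : set (config A)) (Phi : config A -> config A) :=
  homeomorphism_of X Phi /\ forall x, X x -> Phi (shift x) = shift (Phi x).

Definition radius0 (X : set (config A)) (Phi : config A -> config A)
    (phi : A -> A) :=
  forall x, X x -> forall n, Phi x n = phi (x n).

End Shift.

Section Substitution.
Variables (A : finType) (r : nat) (theta : A -> r.-tuple A).

Definition subst_word (w : seq A) : seq A :=
  flatten [seq tval (theta a) | a <- w].

Definition primitive :=
  exists2 k, (0 < k)%N & forall a a', a' \in iter k subst_word [:: a].

(* In the three extensions of theta to infinite words, the default value of nth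
   is used only when r = 0. *)
Definition subst_right (u : nat -> A) : nat -> A :=
  fun n => let a := u (n %/ r)%N in nth a (theta a) (n %% r).

Definition subst_left (v : nat -> A) : nat -> A :=
  fun n => let a := v (n %/ r)%N in nth a (rev (theta a)) (n %% r).

Definition subst_bi (x : config A) : config A :=
  fun n => let a := x (n %/ Posz r)%Z in nth a (theta a) `|(n %% Posz r)%Z|%N.

Definition periodic_bi_infinite (x : config A) :=
  exists v u : nat -> A,
    [/\ exists2 k, (0 < k)%N & iter k subst_left v = v,
        exists2 k, (0 < k)%N & iter k subst_right u = u,
        exists k a, infix [:: v 0%N; u 0%N] (iter k subst_word [:: a])
      & x = bi_infinite v u].

Definition is_substitution_shift (X : set (config A)) :=
  exists2 x, periodic_bi_infinite x & X = orbit_closure x.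

(* F acts on one-sided infinite words, indexed away from the origin. *)
Definition no_fixed_pair_differing_initially
    (F : (nat -> A) -> (nat -> A)) :=
  forall u u', F u = u -> F u' = u' ->
    (forall n, (0 < n)%N -> u n = u' n) -> u = u'.

Definition strongly_injective :=
  [/\ injective theta,
      no_fixed_pair_differing_initially subst_right
    & no_fixed_pair_differing_initially subst_left].

(* The two fixed-point conditions of strong injectivity, for every power
   theta^k.  They follow from strong injectivity of theta if all one-sided
   theta-periodic points are theta-fixed, but not in general: on pairs (a, m)
   with a in Z/3 and m in {0,1}, the substitution
     (a, m) |-> (a+1, m) (a, [a+1 = 0])
   is strongly injective, but its cube is not. *)
Definition powers_fixed_points_separated :=
  forall k, (0 < k)%N ->
    no_fixed_pair_differing_initially (iter k subst_right) /\
    no_fixed_pair_differing_initially (iter k subst_left).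

(* n | gcd S is expressed as: n divides every element of S. *)
Definition height_candidate (u : nat -> A) (n : nat) :=
  [/\ (0 < n)%N, coprime n r & forall a, u a = u 0%N -> (n %| a)%N].

Definition is_height (h : nat) :=
  exists k u, [/\ (0 < k)%N, iter k subst_right u = u, height_candidate u h
    & forall n, height_candidate u n -> (n <= h)%N].

End Substitution.

(* Z/nZ for n > 0; unlike 'Z_n, it is trivial for n = 1. *)
Notation Zmod n := 'I_(n.-1.+1).

Section Adic.
Variable r : nat.

Record adic := Adic {
  adic_coord :> forall n, Zmod (r ^ n);
  adic_compat : forall n, inZp (adic_coord n.+1) = adic_coord n }.

Lemma adic_eq (x y : adic) : (forall n, x n = y n) -> x = y.
Proof.
case: x y => [x xP] [y yP] /= xy; have {}xy : x = y by apply: functional_extensionality_dep.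
by subst y; congr Adic; apply: Prop_irrelevance.
Qed.

Lemma adic_dvdn n : ((r ^ n).-1.+1 %| (r ^ n.+1).-1.+1)%N.
Proof.
case: r n => [|s] [|n]; rewrite ?expn0 ?dvd1n ?exp0n //.
by rewrite !prednK ?expn_gt0 // dvdn_exp2l.
Qed.

Lemma adic_inZpD n (a b : Zmod (r ^ n.+1)) :
  inZp (a + b)%R = inZp a + inZp b :> Zmod (r ^ n).
Proof.
apply: val_inj; rewrite /= modnDm.
exact: (modn_dvdm (val a + val b) (adic_dvdn n)).
Qed.

Lemma adic_zero_subproof n : inZp (0%R : Zmod (r ^ n.+1)) = 0 :> Zmod (r ^ n).
Proof. by apply: val_inj => /=; rewrite mod0n. Qed.

Lemma adic_add_subproof (x y : adic) n :
  inZp (x n.+1 + y n.+1)%R = x n + y n :> Zmod (r ^ n).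
Proof. by rewrite adic_inZpD !adic_compat. Qed.

Lemma adic_opp_subproof (x : adic) n : inZp (- x n.+1)%R = - x n :> Zmod (r ^ n).
Proof.
apply/eqP; rewrite -addr_eq0 -(adic_compat x n) -adic_inZpD addNr.
by rewrite adic_zero_subproof.
Qed.

Definition adic_zero := Adic adic_zero_subproof.
Definition adic_add (x y : adic) := Adic (adic_add_subproof x y).
Definition adic_opp (x : adic) := Adic (adic_opp_subproof x).

Lemma adic_addA : associative adic_add.
Proof. by move=> x y z; apply: adic_eq => n; rewrite /= addrA. Qed.

Lemma adic_addC : commutative adic_add.
Proof. by move=> x y; apply: adic_eq => n; rewrite /= addrC. Qed.

Lemma adic_add0 : left_id adic_zero adic_add.
Proof. by move=> x; apply: adic_eq => n; rewrite /= add0r. Qed.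

Lemma adic_addN : left_inverse adic_zero adic_opp adic_add.
Proof. by move=> x; apply: adic_eq => n; rewrite /= addNr. Qed.

HB.instance Definition _ := gen_eqMixin adic.
HB.instance Definition _ := gen_choiceMixin adic.
HB.instance Definition _ :=
  GRing.isZmodule.Build adic adic_addA adic_addC adic_add0 adic_addN.

End Adic.

Section EquicontinuousFactor.
Variables (A : finType) (r : nat) (theta : A -> r.-tuple A).
Variable X : set (config A).

(* The r-adic integer z such that x lies in sigma^(z mod r^n) (theta^n X) for
   every n (unique when theta is injective and X infinite); xget returns 0 if
   there is no such z. *)
Definition adic_factor (x : config A) : adic r :=
  xget 0 [set z : adic r | forall n,
    [set shiftz (Posz (z n)) (iter n (subst_bi theta) y) | y in X] x].

Definition height_map (h : nat) (p : config A -> discrete_topology (Zmod h)) :=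
  {within X, continuous p} /\
  forall x, X x -> p (shift x) = (p x : Zmod h) + inZp 1.

Definition factor_map (h : nat) (p : config A -> discrete_topology (Zmod h))
    (x : config A) : (adic r * Zmod h)%type := (adic_factor x, p x).

Definition has_kappa (h : nat) (p : config A -> discrete_topology (Zmod h))
    (Phi : config A -> config A) (c : adic r * Zmod h) :=
  forall x, X x -> factor_map p (Phi x) - factor_map p x = c.

End EquicontinuousFactor.

(* Main.v *)
Require Import Defs.
From mathcomp Require Import all_boot all_order all_algebra.
From mathcomp Require Import all_classical.
From mathcomp Require Import topology.
From mathcomp Require Import zify.
Set Implicit Arguments.
Unset Strict Implicit.
Unset Printing Implicit Defensive.
Import GRing.Theory.
Local Open Scope classical_set_scope.
Local Open Scope ring_scope.

(** Let T be theta acting on bi-infinite words.  Since kappa(Phi) = 0 and Phi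
    commutes with the shift, Phi maps T^n X to itself for every n, and the
    injectivity of T^n gives maps Phi_n of X with Phi T^n = T^n Phi_n.  If Phi
    has radius R, then x_q determines the word theta^n(Phi_n(x)_q) except for
    its R first and R last letters.  By strong injectivity of the powers of
    theta, this determines the letter Phi_n(x)_q as soon as n is large, so Phi_n
    has radius 0.  There are finitely many maps of radius 0, hence
    Phi_n = Phi_(n+k) for some n and some k > 0; then Phi commutes with T^k, so
    that Phi = Phi_(mk) for all m, which has radius 0 for m large. *)

(** * The words theta^n(a) and injectivity of theta^n *)

Section Blocks.
Variables (A : finType) (r : nat) (theta : A -> r.-tuple A).
Hypothesis r_gt0 : (0 < r)%N.

(** The first [r ^ n] entries spell theta^n(a). Starting from a constant word gives a total function
    without a default letter. *)
Definition block n (a : A) : nat -> A := iter n (subst_right theta) (fun=> a).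

Lemma iter_subst_rightE n u q j : (j < r ^ n)%N ->
  iter n (subst_right theta) u (q * r ^ n + j)%N = block n (u q) j.
Proof.
elim: n j => [|n IH] j.
  by rewrite expn0 ltnS leqn0 => /eqP ->; rewrite muln1 addn0.
move=> j_lt; rewrite /block !iterS /subst_right.
have -> : ((q * r ^ n.+1 + j) %/ r = q * r ^ n + j %/ r)%N.
  by rewrite expnSr mulnA divnMDl.
have -> : ((q * r ^ n.+1 + j) %% r = j %% r)%N.
  by rewrite expnSr mulnA modnMDl.
by rewrite IH // ltn_divLR // -expnSr.
Qed.

Lemma blockD m n a q j : (j < r ^ m)%N ->
  block (m + n) a (q * r ^ m + j)%N = block m (block n a q) j.
Proof. by move=> j_lt; rewrite {1}/block iterD iter_subst_rightE. Qed.

Lemma block1 a j : (j < r)%N -> block 1 a j = nth a (theta a) j.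
Proof. by move=> j_lt; rewrite /block /= /subst_right modn_small. Qed.

Lemma blockD0 m n a : block (m + n) a 0%N = block m (block n a 0%N) 0%N.
Proof. by rewrite -(@blockD _ _ _ 0) ?expn_gt0 ?r_gt0. Qed.

Hypothesis theta_inj : injective theta.

(** theta^(n+1)(a) is cut into the blocks theta^n(c), with c running through theta(a), so the
    induction hypothesis recovers each letter of theta(a). *)
Lemma block_inj n a b :
  (forall j, (j < r ^ n)%N -> block n a j = block n b j) -> a = b.
Proof.
elim: n a b => [|n IH] a b ab; first exact: (ab 0%N).
apply: theta_inj; apply: val_inj; apply: (@eq_from_nth _ a).
  by rewrite !size_tuple.
move=> i; rewrite size_tuple => i_lt.
have nthE c : nth a (theta c) i = block 1 c i.
  by rewrite block1 // (set_nth_default c) ?size_tuple.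
rewrite !nthE.
apply: IH => j j_lt; rewrite -!blockD // addn1 ab //.
have : (i.+1 * r ^ n <= r ^ n.+1)%N by rewrite expnS leq_mul2r i_lt orbT.
by rewrite mulSn; lia.
Qed.
End Blocks.

Arguments block : simpl never.

(** After [#|A|] steps the orbit has entered its cycle, and some period [#|A| - i] divides the
    factorial. One exponent thus serves for all letters. *)
Lemma iter_card_fact_periodic (A : finType) (f : A -> A) x :
  iter (#|A|)`! f (iter #|A| f x) = iter #|A| f x.
Proof.
have : looping f x #|A|.
  apply: contraT; rewrite -looping_uniq => /card_uniqP; rewrite size_traject.
  by move=> cardE; have := max_card [in traject f x #|A|.+1]; rewrite cardE ltnn.
case/trajectP => i i_lt xE.
have /dvdnP[m ->] : (#|A| - i %| (#|A|)`!)%N.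
  by apply: dvdn_fact; rewrite subn_gt0 i_lt leq_subr.
by rewrite iterM iter_fix // {1}xE -iterD subnK // ltnW.
Qed.

(** * First letters of theta^n(a) and right-infinite fixed points *)

Section FirstLetter.
Variables (A : finType) (r : nat) (theta : A -> r.-tuple A).
Hypothesis r_gt1 : (1 < r)%N.
Hypothesis theta_inj : injective theta.

Let r_gt0 : (0 < r)%N. Proof. exact: ltnW. Qed.
Notation block := (block theta).

Definition inner_agree n a b :=
  forall j, (0 < j < (r ^ n).-1)%N -> block n a j = block n b j.

(** For an inner letter c of theta^n(a), the block theta^d(c) avoids both ends of theta^(d+n)(a),
    and injectivity of theta^d recovers c. *)
Lemma inner_agree_desubst d n a b :
  inner_agree (d + n) a b -> inner_agree n a b.
Proof.
move=> ab j /andP[j_gt0 j_lt]; apply: (block_inj r_gt0 theta_inj (n := d)) => s s_lt.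
rewrite -!blockD //; apply: ab; rewrite addn_gt0 muln_gt0 j_gt0 expn_gt0 r_gt0 /=.
have : (j.+2 * r ^ d <= r ^ n * r ^ d)%N by rewrite leq_mul2r; lia.
by rewrite expnD !mulSn; lia.
Qed.

Lemma block_first n a : block n a 0%N = iter n (fun c => block 1 c 0%N) a.
Proof. by elim: n => [//|n IH]; rewrite iterS -IH -blockD0. Qed.

Lemma block_first_eqW m n a b : (m <= n)%N ->
  block m a 0%N = block m b 0%N -> block n a 0%N = block n b 0%N.
Proof. by move=> /subnK <- ab; rewrite !blockD0 // ab. Qed.

Section PeriodicLetter.
Variables (P : nat) (P_gt0 : (0 < P)%N).

(* The one-sided fixed point of theta^P starting with a letter c such that
   theta^P(c) starts with c. *)
Definition fixed_word (c : A) : nat -> A := fun j => block (P * j) c j.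

Lemma periodic_blockM c m : block P c 0%N = c -> block (P * m) c 0%N = c.
Proof.
move=> cP; elim: m => [|m IH]; first by rewrite muln0.
by rewrite mulnS blockD0 // IH.
Qed.

Lemma ltn_expnM j : (j < r ^ (P * j))%N.
Proof.
by apply: leq_trans (ltn_expl j r_gt1) _; rewrite leq_pexp2l // leq_pmull.
Qed.

(** As theta^P(c) starts with c, the words theta^(P m)(c) are prefixes of one another, and any long
    enough one gives entry [j]. *)
Lemma fixed_wordE c m j : block P c 0%N = c -> (j < r ^ (P * m))%N ->
  fixed_word c j = block (P * m) c j.
Proof.
move=> cP j_lt; rewrite /fixed_word.
have stable m1 m2 : (m1 <= m2)%N -> (j < r ^ (P * m1))%N ->
    block (P * m2) c j = block (P * m1) c j.
  move=> /subnKC <- j_lt1; rewrite mulnDr.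
  by have := blockD theta r_gt0 (P * (m2 - m1)) c 0%N j_lt1; rewrite periodic_blockM.
case: (leqP m j) => [mj|/ltnW jm]; first exact: stable.
by rewrite [RHS](stable j) // ltn_expnM.
Qed.

Lemma fixed_word_fixed c : block P c 0%N = c ->
  iter P (subst_right theta) (fixed_word c) = fixed_word c.
Proof.
move=> cP; apply: functional_extensionality_dep => j.
have s_lt : (j %% r ^ P < r ^ P)%N by rewrite ltn_mod expn_gt0 r_gt0.
have jS : (j < r ^ (P * j.+1))%N.
  by apply: leq_trans (ltn_expnM j) _; rewrite leq_pexp2l // leq_mul2l leqnSn orbT.
rewrite (fixed_wordE cP jS) mulnS; set k := (P * j)%N.
rewrite {1 2}(divn_eq j (r ^ P)).
rewrite iter_subst_rightE // blockD //; congr (block _ _ _).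
apply: fixed_wordE => //; exact: leq_ltn_trans (leq_div _ _) (ltn_expnM j).
Qed.

(** In theta^(P(m+1))(c), the initial block is theta^P(c), where the hypothesis applies; the later
    blocks are images of letters that agree by induction. *)
Lemma fixed_word_agree c d : block P c 0%N = c -> block P d 0%N = d ->
  (forall j, (0 < j < r ^ P)%N -> block P c j = block P d j) ->
  forall j, (0 < j)%N -> fixed_word c j = fixed_word d j.
Proof.
move=> cP dP cd j j_gt0.
suff agree m i : (0 < i < r ^ (P * m))%N -> block (P * m) c i = block (P * m) d i.
  by apply: agree; rewrite j_gt0 ltn_expnM.
elim: m i => [|m IH] i; first by rewrite muln0 expn0; case: i => [|[]].
rewrite mulnS => /andP[i_gt0 i_lt].
have s_lt : (i %% r ^ P < r ^ P)%N by rewrite ltn_mod expn_gt0 r_gt0.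
rewrite (divn_eq i (r ^ P)) !blockD //.
have q_lt : (i %/ r ^ P < r ^ (P * m))%N.
  by rewrite ltn_divLR ?expn_gt0 ?r_gt0 // mulnC -expnD.
case: (posnP (i %/ r ^ P)%N) => [q0|q_gt0]; last by rewrite IH // q_gt0.
rewrite q0 !periodic_blockM // cd // s_lt andbT.
by rewrite lt0n; apply: contraL i_gt0 => /eqP s0; rewrite (divn_eq i (r ^ P)) q0 s0.
Qed.

End PeriodicLetter.

(** The first letters of theta^[#|A|](a) and theta^[#|A|](b) are fixed by the first-letter map of
    theta^P. They start two fixed points of theta^P that agree beyond entry 0, and separation
    identifies them. *)
Lemma inner_agree_first n a b :
  (forall k, (0 < k)%N ->
    no_fixed_pair_differing_initially (iter k (subst_right theta))) ->
  ((#|A|)`! + #|A| <= n)%N -> inner_agree n a b -> block n a 0%N = block n b 0%N.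
Proof.
set P := (#|A|)`! => sep n_ge ab.
have {}ab : inner_agree (P + #|A|) a b.
  by apply: (@inner_agree_desubst (n - (P + #|A|))); rewrite subnK.
have A_gt0 : (0 < #|A|)%N by apply/card_gt0P; exists a.
have P_gt0 : (0 < P)%N := fact_gt0 _.
have periodic c : block P (block #|A| c 0%N) 0%N = block #|A| c 0%N.
  by rewrite !block_first iter_card_fact_periodic.
apply: (block_first_eqW (m := #|A|)); first exact: leq_trans (leq_addl _ _) n_ge.
pose w c := fixed_word P (block #|A| c 0%N).
have wE c : w c 0%N = block #|A| c 0%N by rewrite /w /fixed_word muln0.
rewrite -!wE; congr (_ 0%N); apply: (sep P) => //.
- exact: fixed_word_fixed.
- exact: fixed_word_fixed.
apply: fixed_word_agree => // j /andP[j_gt0 j_lt].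
rewrite -(blockD theta r_gt0 #|A| a 0%N j_lt) -(blockD theta r_gt0 #|A| b 0%N j_lt).
rewrite mul0n add0n; apply: ab; rewrite j_gt0 /=.
(* The prefix of length [r ^ P] stops before the last letter of the long block, since [r ^ #|A|] is
   at least 2. *)
have : (r ^ P * 2 <= r ^ P * r ^ #|A|)%N.
  rewrite leq_mul2l; apply/orP; right.
  by apply: leq_trans r_gt1 _; rewrite -{1}(expn1 r) leq_pexp2l.
by rewrite expnD; move: (r ^ P)%N (r ^ #|A|)%N j_lt => x y; lia.
Qed.

End FirstLetter.

(** * Recovering a letter from the interior of its image *)

Section Separation.
Variables (A : finType) (r : nat) (theta : A -> r.-tuple A).
Hypothesis r_gt1 : (1 < r)%N.
Hypothesis theta_inj : injective theta.
Hypothesis theta_powers : powers_fixed_points_separated theta.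

Let r_gt0 : (0 < r)%N. Proof. exact: ltnW. Qed.

(** Reading backwards turns left-infinite words into right-infinite ones, so that results on first
    letters also yield results on last letters. *)
Definition mirror (a : A) : r.-tuple A := [tuple of rev (theta a)].

Lemma block_mirror n a j : (j < r ^ n)%N ->
  block mirror n a j = block theta n a (r ^ n - j.+1)%N.
Proof.
elim: n a j => [|n IH] a j j_lt; first by [].
have q_lt : (j %/ r < r ^ n)%N by rewrite ltn_divLR // -expnSr.
have s_lt : (j %% r < r)%N by rewrite ltn_mod.
(* The reflection of a position lies in the reflected block, at the reflected offset. *)
have -> : (r ^ n.+1 - j.+1 = (r ^ n - (j %/ r).+1) * r + (r - (j %% r).+1))%N.
  rewrite {1}(divn_eq j r) expnSr mulnBl mulSn.
  have : ((j %/ r).+1 * r <= r ^ n * r)%N by rewrite leq_mul2r q_lt orbT.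
  by rewrite mulSn; lia.
have rsE : (r - (j %% r).+1 < r)%N by lia.
rewrite -[n.+1]add1n {1}(divn_eq j r).
have D (th : A -> r.-tuple A) q s : (s < r)%N ->
    block th (1 + n) a (q * r ^ 1 + s)%N = block th 1 (block th n a q) s.
  by move=> s_lt'; apply: (@blockD _ _ th r_gt0 1); rewrite expn1.
rewrite !D // IH // !block1 // nth_rev ?size_tuple //.
Qed.

Lemma subst_left_mirror : subst_left theta = subst_right mirror.
Proof. by []. Qed.

Lemma mirror_inj : injective mirror.
Proof.
by move=> a b /(congr1 val) /= /(can_inj (@revK _)) ab; apply/theta_inj/val_inj.
Qed.

(** [inner_agree_first], applied to theta and to its mirror, adds both end letters to the agreement;
    injectivity of theta^n concludes. *)
Lemma inner_agree_eq n a b :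
  ((#|A|)`! + #|A| <= n)%N -> inner_agree theta n a b -> a = b.
Proof.
move=> n_ge ab; apply: (block_inj r_gt0 theta_inj (n := n)) => j j_lt.
have first_eq : block theta n a 0%N = block theta n b 0%N.
  by apply: inner_agree_first => // k /theta_powers[].
have last_eq : block theta n a (r ^ n).-1 = block theta n b (r ^ n).-1.
  have n0 : (0 < r ^ n)%N by rewrite expn_gt0 r_gt0.
  rewrite -subn1 -!block_mirror //.
  apply: inner_agree_first => //; first exact: mirror_inj.
    by move=> k /theta_powers[_]; rewrite subst_left_mirror.
  move=> i i_lt; rewrite !block_mirror; [apply: ab | lia | lia].
  by lia.
case: (posnP j) => [->//|j_gt0].
case: (ltngtP j (r ^ n).-1) => [j_lt'| |-> //]; last by lia.
by apply: ab; rewrite j_gt0.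
Qed.

(* Cutting theta^n(a) into blocks theta^m(c) with r^m >= R reduces agreement
   away from the ends to agreement away from the end letters of theta^(n-m). *)
Lemma central_agree_eq (R : nat) n a b :
  ((#|A|)`! + #|A| + R <= n)%N ->
  (forall j, (R <= j < r ^ n - R)%N -> block theta n a j = block theta n b j) ->
  a = b.
Proof.
move=> n_ge ab; have R_lt : (R < r ^ R)%N := ltn_expl R r_gt1.
apply: (@inner_agree_eq (n - R)); first by rewrite leq_subRL; lia.
move=> j /andP[j_gt0 j_lt]; apply: (block_inj r_gt0 theta_inj (n := R)) => s s_lt.
rewrite -!blockD // subnKC; last by lia.
apply: ab; apply/andP; split.
  have : (1 * r ^ R <= j * r ^ R)%N by rewrite leq_mul2r j_gt0 orbT.
  by lia.
have : (j.+2 * r ^ R <= r ^ (n - R) * r ^ R)%N by rewrite leq_mul2r; lia.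
by rewrite -expnD subnK ?mulSn; lia.
Qed.

End Separation.

Lemma intdivP (d : nat) (z : int) : (0 < d)%N ->
  exists q j, z = q * d%:Z + j%:Z /\ (j < d)%N.
Proof.
move=> d_gt0; exists (z %/ d)%Z, `|(z %% d)%Z|%N.
have mod_ge0 : 0 <= (z %% d)%Z by apply: modz_ge0; lia.
have : (z %% d < d)%Z by apply: ltz_pmod; lia.
have := divz_eq z d; lia.
Qed.

(** * Shifts and cylinder neighbourhoods of bi-infinite words *)

Section Configurations.
Variable A : finType.

Lemma shiftz_shiftz i j (x : config A) : shiftz i (shiftz j x) = shiftz (i + j) x.
Proof. by apply: functional_extensionality_dep => n; rewrite /shiftz addrA. Qed.

Lemma shiftz0 (x : config A) : shiftz 0 x = x.
Proof. by apply: functional_extensionality_dep => n; rewrite /shiftz addr0. Qed.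

Lemma shiftzK i (x : config A) : shiftz (- i) (shiftz i x) = x.
Proof. by rewrite shiftz_shiftz addNr shiftz0. Qed.

Definition agree N (x y : config A) := forall i : int, (`|i| <= N)%N -> x i = y i.

Lemma nbhs_agree N (x : config A) : nbhs x [set y | agree N x y].
Proof.
have FF : Filter (nbhs x) := nbhs_filter x.
have coord (i : int) : nbhs x [set y | x i = y i].
  have coord : nbhs x [set y | y i = x i].
    exact: (@proj_continuous _ (fun=> discrete_topology A) i x _ (discrete_set1 _)).
  by apply: filterS coord => y /= <-.
suff : nbhs x [set y | forall k : 'I_N.+1, x k%:Z = y k%:Z /\ x (- k%:Z) = y (- k%:Z)].
  apply: filterS => y xy i i_le; have k_lt : (`|i| < N.+1)%N by [].
  have [Ep En] := xy (Ordinal k_lt); rewrite /= in Ep En.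
  by have [->|->] : i = `|i|%N%:Z \/ i = - `|i|%N%:Z by lia.
apply: (@filter_forall _ _ _ (nbhs x) FF) => k.
exact: filterI (coord _) (coord _).
Qed.

(** The filter generated by the central cylinders around [x] converges to [x], because it does so in
    each coordinate. *)
Lemma nbhs_agreeP (x : config A) (U : set (config A)) :
  nbhs x U -> exists N, [set y | agree N x y] `<=` U.
Proof.
pose F := filter_from [set: nat] (fun N => [set y | agree N x y]).
have FF : Filter F.
  apply: filter_from_filter; first by exists 0%N.
  move=> N M _ _; exists (maxn N M) => // y xy; split=> i i_le; apply: xy; lia.
suff Fx : F --> x by move=> /Fx[N _ NU]; exists N.
apply/cvg_sup => i V [W' [[W] oW <-] WxN WU].
by apply: (filterS WU); exists `|i|%N => // y /= xy; rewrite -(xy i).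
Qed.

Lemma closure_agreeP (S : set (config A)) x :
  closure S x <-> forall N, exists2 y, S y & agree N x y.
Proof.
split=> [clSx N|H U /nbhs_agreeP[N NU]].
  by have [y [Sy xy]] := clSx _ (nbhs_agree N x); exists y.
by have [y Sy xy] := H N; exists y; split=> //; apply: NU.
Qed.

End Configurations.

(** * The action of theta^n on bi-infinite words *)

Section BiInfinite.
Variables (A : finType) (r : nat) (theta : A -> r.-tuple A).
Hypothesis r_gt0 : (0 < r)%N.

Notation block := (block theta).
Notation T n := (iter n (subst_bi theta)).

Lemma subst_biE x q j : (j < r)%N ->
  subst_bi theta x (q * r%:Z + j%:Z) = block 1 (x q) j.
Proof.
move=> j_lt; rewrite block1 // /subst_bi divzMDl; last by lia.
rewrite divz_small ?addr0 ?modzMDl ?modz_small //; lia.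
Qed.

Lemma iter_subst_biE n x q j : (j < r ^ n)%N ->
  T n x (q * (r ^ n)%N%:Z + j%:Z) = block n (x q) j.
Proof.
elim: n j => [|n IH] j.
  by rewrite expn0 ltnS leqn0 => /eqP ->; rewrite mulr1 addr0.
move=> j_lt; have s_lt : (j %% r < r)%N by rewrite ltn_mod.
have -> : q * (r ^ n.+1)%N%:Z + j%:Z =
    (q * (r ^ n)%N%:Z + (j %/ r)%N%:Z) * r%:Z + (j %% r)%N%:Z.
  by rewrite {1}(divn_eq j r) expnSr !PoszD !PoszM mulrDl mulrA addrA.
rewrite iterS subst_biE // IH ?ltn_divLR -?expnSr //.
by rewrite -blockD ?expn1 // -divn_eq.
Qed.

Lemma iter_subst_bi_inj n : injective theta -> injective (fun x : config A => T n x).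
Proof.
move=> theta_inj x y xy; apply: functional_extensionality_dep => q.
apply: (block_inj r_gt0 theta_inj (n := n)) => j j_lt.
by rewrite -!iter_subst_biE // xy.
Qed.

Lemma iter_subst_bi_shiftz n i x :
  T n (shiftz i x) = shiftz (i * (r ^ n)%N%:Z) (T n x).
Proof.
apply: functional_extensionality_dep => z.
have [|q [j [-> j_lt]]] := intdivP z (d := r ^ n); first by rewrite expn_gt0 r_gt0.
rewrite {2}/shiftz addrAC -mulrDl !iter_subst_biE //.
Qed.

End BiInfinite.

(** * Locality of continuous shift-commuting maps *)

Section CurtisHedlund.
Variables (A : finType) (X : set (config A)) (Phi : config A -> config A).

Lemma compact_config : compact [set: config A].
Proof.
have cA (i : int) : compact [set: discrete_topology A].
  exact/finite_compact/finite_finset.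
have := tychonoff cA; congr (compact _).
by apply/seteqP; split.
Qed.

Hypothesis X_closed : closed X.
Hypothesis Phi_cont : {within X, continuous Phi}.

(** Otherwise each [R] has a bad pair. By compactness the first components cluster at some [c] in
    [X], and continuity at [c] contradicts a bad pair of large index close to [c]. *)
Lemma continuous_local0 : exists R, forall x y, X x -> X y -> agree R x y ->
  Phi x 0 = Phi y 0.
Proof.
apply: contrapT => /forallNP nR.
have /choice[xy xyP] : forall R, exists xy : config A * config A,
    [/\ X xy.1, X xy.2, agree R xy.1 xy.2 & Phi xy.1 0 <> Phi xy.2 0].
  move=> R; have /existsNP[x /existsNP[y]] := nR R.
  by rewrite !not_implyE => -[Xx [Xy [ag neq]]]; exists (x, y).
have F_proper : ProperFilter ((fun R => (xy R).1) @ \oo) by exact: fmap_proper_filter.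
have [c [_ c_cluster]] := compact_config F_proper filterT.
have Xc : X c.
  apply: X_closed => U cU; apply: c_cluster => //.
  by exists 0%N => // R _ /=; have [] := xyP R.
have [M MP] : exists M, forall y, X y -> agree M c y -> Phi y 0 = Phi c 0.
  have /subspace_continuousP/(_ c Xc) := Phi_cont.
  move=> /(_ _ (nbhs_agree 0%N (Phi c))) /nbhs_agreeP[M MP].
  by exists M => y Xy cy; have /(_ Xy 0) := MP y cy; rewrite /from_subspace => ->.
have [] := c_cluster [set x | exists2 R, (M <= R)%N & x = (xy R).1] _ _ (nbhs_agree M c).
  by exists M => // R /= MR; exists R.
move=> _ [[R MR ->] cx]; have [X1 X2 ag neq] := xyP R.
(* As [R] is at least [M], the second component also agrees with [c] up to [M]. *)
apply: neq; rewrite (MP _ X1 cx) (MP _ X2) // => i i_le.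
by rewrite cx // ag // (leq_trans i_le).
Qed.

Hypothesis Phi_shiftz : forall i x, X x -> X (shiftz i x) /\
  Phi (shiftz i x) = shiftz i (Phi x).

(** Commutation with shifts brings both positions to the origin. Letting [n] and [m] differ later
    yields one letter map for all positions. *)
Lemma continuous_local : exists R, forall x y n m, X x -> X y ->
  (forall i : int, (`|i| <= R)%N -> x (n + i) = y (m + i)) -> Phi x n = Phi y m.
Proof.
have [R RP] := continuous_local0; exists R => x y n m Xx Xy xy.
have [[Xx' Ex] [Xy' Ey]] := (Phi_shiftz n Xx, Phi_shiftz m Xy).
have := RP _ _ Xx' Xy'; rewrite Ex Ey /shiftz !add0r; apply=> i i_le.
by rewrite ![i + _]addrC xy.
Qed.

End CurtisHedlund.

(** * Finite words and primitivity *)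

Section Words.
Variables (A : finType) (r : nat) (theta : A -> r.-tuple A).
Hypothesis r_gt0 : (0 < r)%N.

Notation block := (block theta).

Lemma size_subst_word w : size (subst_word theta w) = (size w * r)%N.
Proof. by elim: w => // a w IH; rewrite /= size_cat size_tuple IH mulSn. Qed.

Lemma size_iter_subst_word n w :
  size (iter n (subst_word theta) w) = (size w * r ^ n)%N.
Proof.
by elim: n => [|n IH]; rewrite ?muln1 // iterS size_subst_word IH expnSr mulnA.
Qed.

Lemma nth_subst_word d w j : (j < size w * r)%N ->
  nth d (subst_word theta w) j = block 1 (nth d w (j %/ r)) (j %% r).
Proof.
elim: w j => // a w IH j; rewrite [size _]/= mulSn => j_lt.
rewrite /subst_word /= nth_cat size_tuple.
case: ltnP => [j_r|r_j].
  by rewrite divn_small // modn_small // block1 // (set_nth_default a) ?size_tuple.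
rewrite IH; last by lia.
have jE : j = (1 * r + (j - r))%N by lia.
by rewrite {3 4}jE divnMDl // modnMDl.
Qed.

Lemma nth_iter_subst_word d n a j : (j < r ^ n)%N ->
  nth d (iter n (subst_word theta) [:: a]) j = block n a j.
Proof.
elim: n j => [|n IH] j; first by rewrite expn0 ltnS leqn0 => /eqP ->.
rewrite expnSr => j_lt; have s_lt : (j %% r < r)%N by rewrite ltn_mod.
rewrite iterS nth_subst_word; last by rewrite size_iter_subst_word mul1n.
rewrite IH ?ltn_divLR // -[n.+1]add1n {3}(divn_eq j r).
by rewrite -[X in (_ * X)%N]expn1 blockD ?expn1.
Qed.

Hypothesis theta_primitive : primitive theta.

(** With [k0] the exponent of primitivity, the image under theta^k0 of the first letter of
    theta^(k-k0)(a) already contains every letter. *)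
Lemma primitive_occurs : exists k0, forall k a b, (k0 <= k)%N ->
  exists2 q, (q < r ^ k)%N & block k a q = b.
Proof.
have [k0 _ k0P] := theta_primitive; exists k0 => k a b /subnKC <-.
have : b \in iter k0 (subst_word theta) [:: block (k - k0) a 0%N] := k0P _ _.
move=> /(nthP a)[q]; rewrite size_iter_subst_word mul1n => q_lt.
rewrite nth_iter_subst_word // => <-; exists q.
  by apply: leq_trans q_lt _; rewrite leq_pexp2l ?leq_addr.
by have := blockD theta r_gt0 (k - k0) a 0%N q_lt.
Qed.

End Words.

(** * Points described by their finite windows *)

Section Legal.
Variables (A : finType) (r : nat) (theta : A -> r.-tuple A).

(* The restriction of x to [-N, N] is the factor of theta^m(a) centered at s. *)
Definition window_in N (x : config A) m a s :=
  [/\ (N <= s)%N, (s + N < r ^ m)%N &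
      forall i : int, (`|i| <= N)%N -> x i = block theta m a `|(s%:Z + i)%R|%N].

(** This describes the substitution shift by its language, independently of any periodic point.
    Central windows suffice, as every window lies in one. *)
Definition legal : set (config A) :=
  [set x | forall N, exists m a s, window_in N x m a s].

Lemma window_in_le N N' x m a s : (N' <= N)%N ->
  window_in N x m a s -> window_in N' x m a s.
Proof.
move=> N'N [Ns sN xE]; split=> [||i i_le]; [lia|lia|].
by apply: xE; exact: leq_trans N'N.
Qed.

Lemma legal_agree x : (forall N, exists2 y, legal y & agree N x y) -> legal x.
Proof.
move=> xP N; have [y /(_ N)[m [a [s [Ns sN yE]]]] xy] := xP N.
by exists m, a, s; split=> // i i_le; rewrite xy // yE.
Qed.

Lemma legal_shiftz i x : legal x -> legal (shiftz i x).
Proof.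
move=> xL N; have [m [a [s [Ns sN xE]]]] := xL (N + `|i|)%N.
exists m, a, `|(s%:Z + i)%R|%N; split=> [||j j_le]; [lia|lia|].
by rewrite /shiftz xE; [congr (block _ _ _); lia|lia].
Qed.

End Legal.

(** * Identification of the substitution shift with [legal] *)

Section SubstitutionShift.
Variables (A : finType) (r : nat) (theta : A -> r.-tuple A).
Hypothesis r_gt1 : (1 < r)%N.
Hypothesis theta_primitive : primitive theta.

Let r_gt0 : (0 < r)%N. Proof. exact: ltnW. Qed.
Notation block := (block theta).
Notation window_in := (window_in theta).
Notation legal := (legal theta).
Notation T n := (iter n (subst_bi theta)).

Lemma window_in_block N x m n b a q s : (q < r ^ n)%N -> block n b q = a ->
  window_in N x m a s -> window_in N x (m + n) b (q * r ^ m + s).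
Proof.
move=> q_lt bq [Ns sN xE]; split=> [||i i_le]; first by lia.
  have : (q.+1 * r ^ m <= r ^ n * r ^ m)%N by rewrite leq_mul2r q_lt orbT.
  by rewrite addnC expnD mulSn; lia.
have -> : `|((q * r ^ m + s)%N%:Z + i)%R|%N = (q * r ^ m + `|(s%:Z + i)%R|)%N by lia.
by rewrite blockD // ?bq ?xE //; lia.
Qed.

Lemma legal_subst_bi x : legal x -> legal (subst_bi theta x).
Proof.
move=> xL N; have [m [a [s [Ns sN xE]]]] := xL N.
exists (1 + m)%N, a, (s * r)%N.
have sN' : ((s + N).+1 * r <= r ^ m * r)%N by rewrite leq_mul2r sN orbT.
have NrN : (N <= N * r)%N by rewrite leq_pmulr.
split=> [||z z_le].
- by apply: leq_trans Ns _; rewrite leq_pmulr.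
- by rewrite expnD expn1 mulnC; move: sN'; rewrite mulSn mulnDl; lia.
have [q [j [zE j_lt]]] := intdivP z r_gt0.
have q_le : (`|q| <= N)%N by nia.
rewrite {1}zE subst_biE // xE //.
have -> : `|((s * r)%N%:Z + z)%R|%N = (`|(s%:Z + q)%R| * r ^ 1 + j)%N.
  by rewrite expn1; nia.
by rewrite blockD // expn1.
Qed.

Lemma legal_iter_subst_bi n x : legal x -> legal (T n x).
Proof. by move=> xL; elim: n => // n IH; apply: legal_subst_bi. Qed.

Lemma orbit_closure_legal x0 : legal x0 ->
  (forall x N, legal x -> exists i, agree N x (shiftz i x0)) ->
  orbit_closure x0 = legal.
Proof.
move=> x0L dense; apply/seteqP; split=> x.
  move=> /closure_agreeP xcl; apply: legal_agree => N.
  have [_ [i _ <-] xi] := xcl N; exists (shiftz i x0) => //; exact: legal_shiftz.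
move=> xL; apply/closure_agreeP => N; have [i xi] := dense x N xL.
by exists (shiftz i x0) => //; exists i.
Qed.

(** [K] is a common period of the two halves. The two letters at the origin occur at [q] and [q.+1]
    in theta^m(a); applying theta^(K n) places the surroundings of the origin in theta^(K n + m)(a),
    around the cut between the two images. *)
Lemma periodic_bi_infinite_block x0 : periodic_bi_infinite theta x0 ->
  exists K m a q, [/\ (0 < K)%N, (q.+1 < r ^ m)%N,
    forall n (i : int), (`|i| < r ^ (K * n))%N ->
      x0 i = block (K * n + m) a `|((q.+1 * r ^ (K * n))%N%:Z + i)%R|%N
    & forall n j, (j < r ^ (K * n))%N -> x0 j%:Z = block (K * n) (x0 0) j].
Proof.
case=> [v [u [[kv kv_gt0 vE] [ku ku_gt0 uE] [m [a vu]] ->]]].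
pose K := (kv * ku)%N; exists K, m, a.
have K_gt0 : (0 < K)%N by rewrite muln_gt0 kv_gt0.
have uKE n j : (j < r ^ (K * n))%N -> u j = block (K * n) (u 0%N) j.
  have {}uE : iter (K * n) (subst_right theta) u = u.
    by rewrite /K mulnAC iterM iter_fix.
  by move=> j_lt; rewrite -{1}uE; have := iter_subst_rightE theta r_gt0 u 0 j_lt.
have vKE n j : (j < r ^ (K * n))%N -> v j = block (K * n) (v 0%N) (r ^ (K * n) - j.+1).
  have {}vE : iter (K * n) (subst_left theta) v = v.
    by rewrite /K -mulnA mulnC iterM iter_fix.
  move=> j_lt; rewrite -{1}vE subst_left_mirror -block_mirror //.
  by have := iter_subst_rightE (mirror theta) r_gt0 v 0 j_lt.
have /infixP[s [s' wE]] := vu; exists (size s).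
have := size_iter_subst_word theta m [:: a].
rewrite wE !size_cat mul1n /= => sizeE.
have s_lt : ((size s).+1 < r ^ m)%N by rewrite -sizeE addnA addn2 leq_addr.
have vE' : block m a (size s) = v 0%N.
  by rewrite -(nth_iter_subst_word theta r_gt0 a) ?wE ?nth_cat ?ltnn ?subnn // ltnW.
have uE' : block m a (size s).+1 = u 0%N.
  rewrite -(nth_iter_subst_word theta r_gt0 a) ?wE ?nth_cat //.
  by rewrite ltnNge leqnSn subSnn.
split=> // n i i_lt.
have [j] : exists j : nat, i = Posz j \/ i = Negz j.
  by case: i {i_lt} => j; exists j; [left|right].
case=> iE; rewrite iE in i_lt *; rewrite /=.
- rewrite (uKE n) // -uE' -blockD //; congr (block _ _ _); lia.
- have j_lt : (j < r ^ (K * n))%N by lia.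
  rewrite (vKE n) // -vE' -blockD //; last by lia.
  congr (block _ _ _); rewrite mulSn NegzE.
  by move: (r ^ (K * n))%N (size s) j_lt => x q j_lt; lia.
Qed.

Lemma periodic_bi_infinite_legal x0 : periodic_bi_infinite theta x0 -> legal x0.
Proof.
case/periodic_bi_infinite_block=> [K [m [a [q [K_gt0 q_lt xE _]]]]] N.
have N_lt := ltn_expnM r_gt1 K_gt0 N.
exists (K * N + m)%N, a, (q.+1 * r ^ (K * N))%N; split.
- by rewrite mulSn; lia.
- have : (q.+2 * r ^ (K * N) <= r ^ m * r ^ (K * N))%N by rewrite leq_mul2r q_lt orbT.
  by rewrite addnC expnD !mulSn; lia.
- by move=> i i_le; rewrite (xE N) //; exact: leq_ltn_trans N_lt.
Qed.

(** For density of the orbit, a window inside theta^m(a) is found in theta^(K(k0+m)) of the letter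
    at the origin, which is a prefix of the right half. The exponent is a multiple of [K] and
    exceeds [m] by at least [k0]. *)
Lemma substitution_shift_legal X : is_substitution_shift theta X -> X = legal.
Proof.
case=> x0 x0P ->; apply: orbit_closure_legal; first exact: periodic_bi_infinite_legal.
have [K [_ [_ [_ [K_gt0 _ _ xE]]]]] := periodic_bi_infinite_block x0P.
have [k0 k0P] := primitive_occurs r_gt0 theta_primitive.
move=> x N /(_ N)[m [a [s win]]].
have m_le : (m <= K * (k0 + m))%N by apply: leq_trans (leq_pmull _ K_gt0); lia.
have [|q q_lt qE] := k0P (K * (k0 + m) - m)%N (x0 0) a.
  have : (k0 + m <= K * (k0 + m))%N by rewrite leq_pmull.
  by lia.
have := window_in_block q_lt qE win; rewrite subnKC //.
set t := (_ + s)%N => -[Nt tN tE].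
exists t%:Z => i i_le; rewrite tE // /shiftz.
have -> : i + t%:Z = `|(t%:Z + i)%R|%N%:Z by lia.
by rewrite -xE //; lia.
Qed.

End SubstitutionShift.

(** * Desubstitution, r-adic digits and minimality *)

Section Desubstitution.
Variables (A : finType) (r : nat) (theta : A -> r.-tuple A).
Hypothesis r_gt1 : (1 < r)%N.
Hypothesis theta_primitive : primitive theta.
Hypothesis theta_inj : injective theta.

Let r_gt0 : (0 < r)%N. Proof. exact: ltnW. Qed.
Notation block := (block theta).
Notation T n := (iter n (subst_bi theta)).
Notation legal := (legal theta).
Notation window_in := (window_in theta).

(* The position of the cutting points of a window modulo r takes finitely many
   values, hence one value serves for all windows of x. *)
Lemma legal_phase x : legal x -> exists2 t, (t < r)%N &
  forall N, exists m a s, window_in N x (1 + m) a s /\ (s %% r)%N = t.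
Proof.
move=> xL; apply: contrapT => no_phase.
have /choice[M MP] : forall t : 'I_r, exists N,
    ~ exists m a s, window_in N x (1 + m) a s /\ (s %% r)%N = t.
  move=> t; apply/existsNP => tP; apply: no_phase.
  by exists t => //; exact: ltn_ord.
have [k0 k0P] := primitive_occurs r_gt0 theta_primitive.
have [m [a [s win]]] := xL (\max_t M t)%N.
(* The extra power gives the total exponent the form [1 + _] even when [m] is 0. *)
have [q q_lt qa] := k0P k0.+1 a a (leqnSn _).
have s_lt : ((q * r ^ m + s) %% r < r)%N by rewrite ltn_mod.
apply: (MP (Ordinal s_lt)); exists (m + k0)%N, a, (q * r ^ m + s)%N; split=> //.
apply: (window_in_le (leq_bigmax (Ordinal s_lt))).
rewrite add1n -addnS.
exact (window_in_block r_gt1 q_lt qa win).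
Qed.

(** With a common phase, all windows are cut into blocks theta(c) at the same places. Injectivity
    makes c independent of the window, so these letters assemble into a legal point. *)
Lemma legal_desubst x : legal x -> exists t y,
  [/\ (t < r)%N, legal y & x = shiftz t%:Z (subst_bi theta y)].
Proof.
move=> /legal_phase[t t_lt tP].
have cut N : exists m a q0, [/\ (N <= q0)%N, (q0 + N < r ^ m)%N &
    forall p j, (`|p| <= N)%N -> (j < r)%N ->
      x (p * r%:Z + j%:Z - t%:Z) = block 1 (block m a `|(q0%:Z + p)%R|%N) j].
  (* The two extra blocks make room for the offsets [j] and [t], both below [r]. *)
  have [m [a [s [[Ns sN xE] st]]]] := tP (N.+2 * r)%N.
  exists m, a, (s %/ r)%N; have sE := divn_eq s r; rewrite st in sE.
  split.
  - by rewrite leq_divRL //; apply: leq_trans Ns; rewrite leq_mul2r; lia.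
  - rewrite expnD expn1 in sN.
    rewrite -(ltn_pmul2r r_gt0) mulnDl [X in (_ < X)%N]mulnC.
    by apply: leq_ltn_trans sN; rewrite !mulSn; lia.
  - move=> p j p_le j_lt; rewrite xE; last by rewrite !mulSn; nia.
    have -> : `|(s%:Z + (p * r%:Z + j%:Z - t%:Z))%R|%N =
        (`|((s %/ r)%N%:Z + p)%R| * r ^ 1 + j)%N.
      have q_ge : (N <= s %/ r)%N.
        by rewrite leq_divRL //; apply: leq_trans Ns; rewrite leq_mul2r; lia.
      by rewrite expn1; move: (s %/ r)%N q_ge sE => q q_ge ->; nia.
    by rewrite blockD // expn1.
have /choice[y yE] : forall p : int, exists c, forall j, (j < r)%N ->
    x (p * r%:Z + j%:Z - t%:Z) = block 1 c j.
  move=> p; have [m [a [q0 [_ _ xE]]]] := cut `|p|%N.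
  by exists (block m a `|(q0%:Z + p)%R|%N) => j j_lt; rewrite xE.
exists t, y; split=> //.
  move=> N; have [m [a [q0 [Nq qN xE]]]] := cut N.
  exists m, a, q0; split=> // p p_le.
  apply: (block_inj r_gt0 theta_inj (n := 1)) => j; rewrite expn1 => j_lt.
  by rewrite -yE // -xE.
apply: functional_extensionality_dep => z; rewrite /shiftz.
have [q [j [zE j_lt]]] := intdivP (z + t%:Z) r_gt0.
by rewrite zE subst_biE // -yE // -zE addrK.
Qed.

Lemma shiftz_subst_bi_iter (t i : int) n (y : config A) :
  shiftz i (T n (shiftz t (subst_bi theta y))) =
  shiftz (i + t * (r ^ n)%N%:Z) (T n.+1 y).
Proof. by rewrite iter_subst_bi_shiftz // shiftz_shiftz -iterSr. Qed.

(* The digits of the r-adic integer are the successive phases of the iterated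
   desubstitution of x. *)
Lemma legal_adic x : legal x -> exists z : adic r, forall n,
  [set shiftz (Posz (z n)) (T n y) | y in legal] x.
Proof.
move=> xL.
have /choice[des desP] : forall x : config A, exists ty : nat * config A,
    legal x -> [/\ (ty.1 < r)%N, legal ty.2 & x = shiftz ty.1%:Z (subst_bi theta ty.2)].
  move=> {xL}x; have [/legal_desubst[t [y xP]]|nxL] := pselect (legal x).
    by exists (t, y).
  by exists (0%N, x).
pose X n := iter n (fun y => (des y).2) x.
have XL n : legal (X n) by elim: n => // n /desP[].
pose d n := \sum_(k < n) ((des (X k)).1 * r ^ k)%N.
have dS n : d n.+1 = (d n + (des (X n)).1 * r ^ n)%N by rewrite /d big_ord_recr.
have d_lt n : (d n < r ^ n)%N.
  elim: n => [|n IH]; first by rewrite /d big_ord0.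
  have [t_lt _ _] := desP _ (XL n); rewrite dS.
  have : ((des (X n)).1.+1 * r ^ n <= r * r ^ n)%N by rewrite leq_mul2r t_lt orbT.
  by rewrite mulSn expnS; lia.
have xE n : x = shiftz (d n)%:Z (T n (X n)).
  elim: n => [|n IH]; first by rewrite /d big_ord0 shiftz0.
  have [_ _ XE] := desP _ (XL n).
  by rewrite {1}IH {1}XE shiftz_subst_bi_iter dS PoszD PoszM.
have rn n : (r ^ n).-1.+1 = (r ^ n)%N by rewrite prednK // expn_gt0 r_gt0.
have compat n : inZp (inZp (d n.+1) : Zmod (r ^ n.+1)) = inZp (d n) :> Zmod (r ^ n).
  apply: val_inj; rewrite /= !rn dS modn_dvdm; last by rewrite dvdn_exp2l.
  by rewrite addnC modnMDl.
exists (Adic compat) => n; exists (X n) => //=.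
by rewrite rn modn_small // -xE.
Qed.

(** Desubstituting [y] far enough exhibits in it a block theta^(m+k0)(c), which contains theta^m(a)
    and hence the window of [x]. *)
Lemma legal_minimal x y N : legal x -> legal y -> exists i, agree N x (shiftz i y).
Proof.
move=> /(_ N)[m [a [s win]]] yL.
have [k0 k0P] := primitive_occurs r_gt0 theta_primitive.
have [z /(_ (m + k0)%N)[y' y'L <-]] := legal_adic yL.
have [q q_lt qE] := k0P k0 (y' 0) a (leqnn _).
have := window_in_block r_gt1 q_lt qE win.
set t := (_ + s)%N => -[Nt tN tE].
exists (t%:Z - Posz (z (m + k0)%N)) => i i_le; rewrite shiftz_shiftz subrK tE //.
rewrite /shiftz.
have -> : i + t%:Z = 0 * (r ^ (m + k0))%N%:Z + `|(t%:Z + i)%R|%N%:Z by lia.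
by rewrite iter_subst_biE //; lia.
Qed.

End Desubstitution.

(** * Maps compatible with the images of all T^n *)

Section FiberPreserving.
Variables (A : finType) (r : nat) (theta : A -> r.-tuple A).
Hypothesis r_gt1 : (1 < r)%N.
Hypothesis theta_primitive : primitive theta.
Hypothesis theta_inj : injective theta.
Hypothesis theta_powers : powers_fixed_points_separated theta.

Let r_gt0 : (0 < r)%N. Proof. exact: ltnW. Qed.
Notation block := (block theta).
Notation T n := (iter n (subst_bi theta)).
Notation legal := (legal theta).

Variables (Phi : config A -> config A) (R : nat).
Hypothesis Phi_shiftz : forall i x, legal x -> Phi (shiftz i x) = shiftz i (Phi x).
Hypothesis Phi_local : forall x y n m, legal x -> legal y ->
  (forall i : int, (`|i| <= R)%N -> x (n + i) = y (m + i)) -> Phi x n = Phi y m.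
Hypothesis Phi_fiber : forall n, exists y y',
  [/\ legal y, legal y' & Phi (T n y) = T n y'].

(** By minimality, [x] looks like a shift of the given [y] on any window. Locality transfers the
    block structure of Phi(T^n y) to Phi(T^n x), and injectivity makes the block letters
    consistent. *)
Lemma preserves_fibers n x : legal x -> exists2 y, legal y & Phi (T n x) = T n y.
Proof.
move=> xL; have [y [y' [yL y'L yy']]] := Phi_fiber n.
have rn_gt0 : (0 < r ^ n)%N by rewrite expn_gt0 r_gt0.
have near N : exists k, forall q j, (`|q| <= N)%N -> (j < r ^ n)%N ->
    Phi (T n x) (q * (r ^ n)%N%:Z + j%:Z) = block n (shiftz k y' q) j.
  (* Every coordinate within [R] of block [q] lies in a block of index at most [N + R + 1] in
     absolute value. *)
  have [k xy] := legal_minimal r_gt1 theta_primitive theta_inj (N + R + 1)%N xL yL.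
  exists k => q j q_le j_lt; rewrite -iter_subst_biE // iter_subst_bi_shiftz // -yy'.
  rewrite -Phi_shiftz -?iter_subst_bi_shiftz //; last exact: legal_iter_subst_bi.
  apply: Phi_local => [||i i_le]; try apply: legal_iter_subst_bi => //.
    exact: legal_shiftz.
  have [q' [j' [zE j'_lt]]] := intdivP (q * (r ^ n)%N%:Z + j%:Z + i) rn_gt0.
  have q'_le : (`|q'| <= N + R + 1)%N.
    by move: (r ^ n)%N rn_gt0 j_lt j'_lt zE => M *; nia.
  by rewrite zE !iter_subst_biE // xy.
have /choice[z zE] : forall q, exists c, forall j, (j < r ^ n)%N ->
    Phi (T n x) (q * (r ^ n)%N%:Z + j%:Z) = block n c j.
  by move=> q; have [k kP] := near `|q|%N; exists (shiftz k y' q) => j; apply: kP.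
exists z.
  apply: legal_agree => N; have [k kP] := near N.
  exists (shiftz k y'); first exact: legal_shiftz.
  move=> q q_le; apply: (block_inj r_gt0 theta_inj (n := n)) => j j_lt.
  by rewrite -zE // kP.
apply: functional_extensionality_dep => i.
have [q [j [-> j_lt]]] := intdivP i rn_gt0.
by rewrite zE // iter_subst_biE.
Qed.

(** This is the map Phi_n; the default [x] is never reached on legal points. *)
Definition desubst_map n x : config A :=
  if pselect (exists2 y, legal y & Phi (T n x) = T n y) is left e
  then projT1 (cid2 e) else x.

Lemma desubst_mapP n x : legal x ->
  legal (desubst_map n x) /\ Phi (T n x) = T n (desubst_map n x).
Proof.
move=> /(preserves_fibers n) ex; rewrite /desubst_map; case: pselect => // e.
by case: cid2.
Qed.

Let n1 := ((#|A|)`! + #|A| + R)%N.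

(** At distance at least [R] from the ends of block [q], Phi sees only theta^n(x q). The threshold
    [n1] is that of [central_agree_eq]. *)
Lemma desubst_map_letter n x y q q' : (n1 <= n)%N -> legal x -> legal y ->
  x q = y q' -> desubst_map n x q = desubst_map n y q'.
Proof.
move=> n_ge xL yL xy; apply: (central_agree_eq r_gt1 theta_inj theta_powers n_ge).
move=> j /andP[j_ge j_lt]; have j_lt' : (j < r ^ n)%N by lia.
have [_ xE] := desubst_mapP n xL; have [_ yE] := desubst_mapP n yL.
rewrite -!iter_subst_biE // -xE -yE.
apply: Phi_local; try exact: legal_iter_subst_bi.
move=> i i_le; rewrite -!addrA.
have -> : j%:Z + i = `|(j%:Z + i)%R|%N%:Z by lia.
by rewrite !iter_subst_biE ?xy //; lia.
Qed.

(** A finite function, rather than a bare map, places the code in a finite type for the pigeonhole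
    argument. *)
Lemma desubst_map_code n : (n1 <= n)%N -> exists phi : {ffun A -> A},
  forall x q, legal x -> desubst_map n x q = phi (x q).
Proof.
move=> n_ge.
have /choice[phi phiP] : forall a, exists c, forall x q, legal x -> x q = a ->
    desubst_map n x q = c.
  move=> a; have [[x [q [xL xa]]]|nex] := pselect (exists x q, legal x /\ x q = a).
    exists (desubst_map n x q) => y q' yL ya.
    by apply: desubst_map_letter => //; rewrite ya.
  (* This is a dummy value, for a letter that occurs in no legal point. *)
  by exists a => x q xL xa; case: nex; exists x, q.
by exists (finfun phi) => x q xL; rewrite ffunE; apply: phiP.
Qed.

Lemma desubst_map_repeat : exists n k, (0 < k)%N /\
  forall x, legal x -> desubst_map (k + n) x = desubst_map n x.
Proof.
have /choice[code codeP] : forall i, exists phi : {ffun A -> A},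
    forall x q, legal x -> desubst_map (n1 + i) x q = phi (x q).
  by move=> i; apply: desubst_map_code; exact: leq_addr.
have [i [j [ij ijE]]] : exists i j, (i < j)%N /\ code i = code j.
  pose f (i : 'I_(#|{ffun A -> A}|.+1)) := code i.
  have /injectivePn[i [j ij fij]] : ~~ injectiveb f.
    apply/negP => /injectiveP /leq_card; by rewrite card_ord ltnn.
  case: (ltngtP i j) => [lt|lt|/val_inj eq]; last by rewrite eq eqxx in ij.
    by exists i, j.
  by exists j, i.
exists (n1 + i)%N, (j - i)%N; split=> [|x xL]; first by lia.
have -> : (j - i + (n1 + i) = n1 + j)%N by lia.
by apply: functional_extensionality_dep => q; rewrite !codeP // ijE.
Qed.

(** Up to a shift, [x] is T^n y, and Phi(T^(k+n) y) = T^(k+n)(Phi_n(y)) = T^k(Phi(T^n y)). *)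
Lemma commutes_power : exists2 k, (0 < k)%N &
  forall x, legal x -> Phi (T k x) = T k (Phi x).
Proof.
have [n [k [k_gt0 repeat]]] := desubst_map_repeat; exists k => // x xL.
have [z /(_ n)[y yL <-]] := legal_adic r_gt1 theta_primitive theta_inj xL.
have [_ yE] := desubst_mapP n yL; have [_ yE'] := desubst_mapP (k + n) yL.
rewrite Phi_shiftz ?iter_subst_bi_shiftz ?Phi_shiftz //; try exact: legal_iter_subst_bi.
  by rewrite -iterD yE' repeat // iterD yE.
by rewrite -iterD; exact: legal_iter_subst_bi.
Qed.

(* A map commuting with theta^k on X equals its own desubstitutions of all
   orders divisible by k, and these have radius 0 from some order on. *)
Lemma fiber_preserving_radius0 : exists phi, radius0 legal Phi phi.
Proof.
have [k k_gt0 comm] := commutes_power.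
have commM m x : legal x -> Phi (T (m * k) x) = T (m * k) (Phi x).
  move=> xL; elim: m => // m IH.
  by rewrite mulSn !iterD comm ?IH //; exact: legal_iter_subst_bi.
have [|phi phiP] := @desubst_map_code (n1 * k)%N; first exact: leq_pmulr.
exists phi => x xL q; rewrite -phiP //; congr (_ q).
apply: (iter_subst_bi_inj r_gt0 (n := (n1 * k)%N) theta_inj).
by have [_ <-] := desubst_mapP (n1 * k) xL; rewrite commM.
Qed.

End FiberPreserving.

(** * The action of a radius 0 automorphism on the language *)

Lemma radius0_language_automorphism (A : finType) (X : set (config A))
    (Phi : config A -> config A) (phi : A -> A) :
  homeomorphism_of X Phi -> radius0 X Phi phi ->
  language_automorphism (language X) (map phi).
Proof.
move=> [Psi [PhiX PsiX _ _]] Phi0.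
have word_phi x i l : X x -> map phi (word_at x i l) = word_at (Phi x) i l.
  by move=> Xx; rewrite /word_at -map_comp; apply: eq_map => k /=; rewrite Phi0.
have size_word (x : config A) i l : size (word_at x i l) = l.
  by rewrite size_map size_iota.
pose B := [set a : A | `[< exists x n, X x /\ x n = a >]]%SET.
(* The inverse of [Phi] makes [phi] cover the letters that occur in [X]; by counting, [phi] is
   injective on them. *)
have B_surj : B \subset (phi @: B)%SET.
  apply/fintype.subsetP => a; rewrite inE => /asboolP[x [n [Xx <-]]].
  have [XPsi PhiPsi] := PsiX x Xx.
  apply/imsetP; exists (Psi x n); last by rewrite -Phi0 // PhiPsi.
  by rewrite inE; apply/asboolP; exists (Psi x), n.
have phi_inj : {in B &, injective phi}.
  apply/imset_injP; rewrite eqn_leq leq_imset_card.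
  exact: subset_leq_card.
have word_B w : language X w -> {subset w <= B}.
  move=> [x [i [Xx ->]]] a /mapP[k _ ->]; rewrite inE; apply/asboolP.
  by exists x, (i + k%:Z).
split; last by move=> w1 w2 _ _ _; rewrite map_cat.
split.
- move=> w [x [i [Xx wE]]]; exists (Phi x), i; split; first by have [] := PhiX x Xx.
  by rewrite wE word_phi // !size_word.
- move=> w1 w2 /set_mem /word_B w1B /set_mem /word_B w2B.
  elim: w1 w2 w1B w2B => [|a w1 IH] [|b w2] //= w1B w2B [ab w12].
  have -> : a = b by apply: phi_inj ab; [apply: w1B|apply: w2B]; rewrite mem_head.
  by rewrite (IH w2) // => c cw; [apply: w1B|apply: w2B]; rewrite inE cw orbT.
- move=> w [x [i [Xx wE]]]; have [XPsi PhiPsi] := PsiX x Xx.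
  exists (word_at (Psi x) i (size w)); last by rewrite word_phi // PhiPsi.
  by exists (Psi x), i; rewrite size_word.
Qed.

(** * Reduction of the theorem to fibre-preserving maps *)

Lemma automorphism_shiftz (A : finType) (X : set (config A))
    (Phi : config A -> config A) :
  (forall i x, X x -> X (shiftz i x)) ->
  (forall x, X x -> Phi (shift x) = shift (Phi x)) ->
  forall i x, X x -> Phi (shiftz i x) = shiftz i (Phi x).
Proof.
move=> X_shiftz comm.
have commn (n : nat) x : X x -> Phi (shiftz n%:Z x) = shiftz n%:Z (Phi x).
  move=> Xx; elim: n => [|n IH]; first by rewrite !shiftz0.
  rewrite -add1n PoszD -!shiftz_shiftz -IH; apply: comm; exact: X_shiftz.
move=> [n|n] x Xx; first exact: commn.
rewrite NegzE -[in RHS](shiftzK (- n.+1%:Z) x) opprK.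
by rewrite commn ?shiftzK //; exact: X_shiftz.
Qed.

(** If [r] is at most 1, theta^k(a) has at most one letter, so primitivity leaves a single letter
    and [X] has at most one point. *)
Lemma infinite_shift_length (A : finType) (r : nat) (theta : A -> r.-tuple A)
    (X : set (config A)) :
  primitive theta -> infinite_set X -> (1 < r)%N.
Proof.
move=> [k k_gt0 kP] X_inf; rewrite ltnNge; apply/negP => r_le1; apply: X_inf.
have AE (a b : A) : a = b.
  have := size_iter_subst_word theta k [:: a]; have aI := kP a a; have bI := kP a b.
  case: (iter _ _ _) aI bI => [|c [|d w]] //.
    by rewrite !inE => /eqP-> /eqP->.
  move=> _ _; rewrite mul1n /= => sizeE.
  by have := @leq_exp2r r 1 k k_gt0; rewrite exp1n -sizeE r_le1.
have [->|/set0P[x Xx]] := eqVneq X set0; first exact: finite_set0.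
apply: (@sub_finite_set _ _ [set x]); last exact: finite_set1.
by move=> y _; apply: functional_extensionality_dep => n; apply: AE.
Qed.

Theorem theorem33 (A : finType) (r : nat) (theta : A -> r.-tuple A)
    (X : set (config A)) (h : nat)
    (p : config A -> discrete_topology (Zmod h))
    (Phi : config A -> config A)
    (theta_primitive : primitive theta)
    (theta_si : strongly_injective theta)
    (theta_powers : powers_fixed_points_separated theta)
    (X_theta : is_substitution_shift theta X)
    (X_infinite : infinite_set X)
    (h_height : is_height theta h)
    (p_height_map : height_map X p)
    (Phi_aut : automorphism X Phi)
    (Phi_kappa : has_kappa theta X p Phi 0) :
  exists2 phi : A -> A, radius0 X Phi phi &
    language_automorphism (language X) (map phi).
Proof.
have r_gt1 := infinite_shift_length theta_primitive X_infinite.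
have [theta_inj _ _] := theta_si.
have X_legal := substitution_shift_legal r_gt1 theta_primitive X_theta.
have X_closed : closed X by have [x0 _ ->] := X_theta; exact: closed_closure.
subst X; pose f := adic_factor theta (legal theta).
have [[Psi [PhiX PsiX Phi_cont Psi_cont]] Phi_shift] := Phi_aut.
have Phi_shiftz := automorphism_shiftz (@legal_shiftz _ _ theta) Phi_shift.
have [R Phi_local] := continuous_local X_closed Phi_cont
  (fun i x Xx => conj (legal_shiftz i Xx) (Phi_shiftz i x Xx)).
have factor_mem x : legal theta x -> forall n,
    [set shiftz (Posz (f x n)) (iter n (subst_bi theta) y) | y in legal theta] x.
  move=> Xx; exact: (xgetPex 0 (legal_adic r_gt1 theta_primitive theta_inj Xx)).
have Phi_fiber n : exists y y',
    [/\ legal theta y, legal theta y'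
      & Phi (iter n (subst_bi theta) y) = iter n (subst_bi theta) y'].
  have [x Xx] := infinite_setN0 X_infinite.
  have [XPhi _] := PhiX x Xx.
  (* The adic coordinate of kappa(Phi) = 0 gives [x] and [Phi x] the same residue modulo [r ^ n];
     shifting both back by it lands in the image of T^n. *)
  have factorE : f (Phi x) = f x.
    by apply: subr0_eq; have := congr1 (fun z => z.1) (Phi_kappa x Xx).
  have [y Xy yE] := factor_mem x Xx n; have [y' Xy' y'E] := factor_mem _ XPhi n.
  exists y, y'; split=> //; rewrite factorE in y'E.
  have TyE : iter n (subst_bi theta) y = shiftz (- Posz (f x n)) x.
    exact: etrans (esym (shiftzK _ _)) (congr1 _ yE).
  by rewrite TyE Phi_shiftz // -y'E shiftzK.
have [phi Phi0] := fiber_preserving_radius0 r_gt1 theta_primitive theta_inj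
  theta_powers Phi_shiftz Phi_local Phi_fiber.
exists phi => //; apply: radius0_language_automorphism Phi0.
by exists Psi.
Qed.
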